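(* Let $n_1>\dots>n_k$ and $m_1>\dots>m_\ell$ be positive integers with $(n_1,\dots,n_k)\succ(m_1,\dots,m_\ell)$. If $F_{2n_1+1}F_{2n_2+1}\cdots F_{2n_k+1}=F_{2m_1+1}F_{2m_2+1}\cdots F_{2m_\ell+1}$, then $k=\ell$ and $m_i=n_i$ for all $i$.
   Context: $F_n$ is the Fibonacci sequence with $F_0=1$, $F_1=1$, $F_{n+2}=F_{n+1}+F_n$ for $n\ge0$. Majorization: for finite non-increasing sequences of positive integers $(a_1,\dots,a_n)$ and $(b_1,\dots,b_k)$, write $(a_1,\dots,a_n)\succ(b_1,\dots,b_k)$ if: (1) $n\le k$; (2) for every $i\le n$, $a_1+\dots+a_i\ge b_1+\dots+b_i$; (3) $a_1+\dots+a_n\ge b_1+\dots+b_k$. *)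

(* Defs.v *)
From mathcomp Require Import all_boot.
Set Implicit Arguments.
Unset Strict Implicit.
Unset Printing Implicit Defensive.

(* Fibonacci numbers with the convention F_0 = F_1 = 1. *)
Fixpoint fib (n : nat) : nat :=
  match n with
  | 0 => 1
  | n'.+1 => match n' with
             | 0 => 1
             | n''.+1 => fib n' + fib n''
             end
  end.

(* [majorizes a b] is a ≻ b; note that the lengths may differ and that the total
   sums are only compared by an inequality.  It is meant for non-increasing
   sequences of positive integers. *)
Definition majorizes (a b : seq nat) : Prop :=
  [/\ size a <= size b,
      forall i, i <= size a -> sumn (take i b) <= sumn (take i a)
    & sumn b <= sumn a].

(* Main.v *)
Require Import Defs.
From mathcomp Require Import all_boot.
From mathcomp Require Import all_order all_algebra all_field.
From mathcomp Require Import ring zify.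
Set Implicit Arguments.
Unset Strict Implicit.
Unset Printing Implicit Defensive.
Import Order.TTheory GRing.Theory Num.Theory.

(* Carmichael's theorem for the Lucas sequence [u n = (alpha ^ n - beta ^ n) /
   (alpha - beta)], where [alpha] and [beta] are the roots of X^2 - 3 X + 1: if
   [1 < n] and [n != 6], then [u n] has a prime factor dividing no earlier
   [u i].  The factor of [u n] carried by the primitive [n]-th roots of unity
   is an integer of absolute value at least 5 ^ (totient n / 2), which exceeds
   [n] unless [n = 6], while it would divide [n] if [u n] had no primitive prime
   factor.  Hence the largest index of a product of distinct [u i] is determined
   by the product ([u 6 = 144] does not divide 3 * 8 * 21 * 55), and induction
   on the sequences concludes. *)

(** * Lower bounds for the totient *)

(** Induction splitting off the full power of the least prime factor [p]; since [p >= 3],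
    [p <= (p - 1) ^ 2]. *)
Lemma odd_leq_totient_sq n : odd n -> n <= totient n ^ 2.
Proof.
elim/ltn_ind: n => n IHn odd_n; have n_gt0 := odd_gt0 odd_n.
have [|n_gt1] := leqP n 1; first by case: n n_gt0 {IHn odd_n} => [|[]].
set p := pdiv n; have p_pr : prime p by apply: pdiv_prime.
have p_n : p %| n by apply: pdiv_dvd.
have e_gt0 : 0 < logn p n by rewrite logn_gt0 mem_primes p_pr n_gt0.
have [m co_pm Dn] := pfactor_coprime p_pr n_gt0.
have odd_p : odd p by apply: dvdn_odd odd_n.
have p_ge3 : 2 < p by rewrite odd_prime_gt2.
have odd_m : odd m by move: odd_n; rewrite Dn oddM => /andP[].
move: Dn e_gt0; case: (logn p n) => // e Dn _.
have m_lt : m < n.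
  rewrite {}Dn -[ltnLHS]muln1 ltn_pmul2l ?odd_gt0 // -(expn0 p) ltn_exp2l //.
  exact: prime_gt1.
rewrite [in leqRHS]Dn totient_coprime; last by rewrite coprime_sym coprimeXl.
rewrite totient_pfactor // Dn !expnMn leq_mul ?IHn //= expnS leq_mul //.
  by rewrite -(prednK (prime_gt0 p_pr)) in p_ge3 *; nia.
by rewrite -expnM leq_pexp2l ?prime_gt0 // leq_pmulr.
Qed.

(** Only the power of 2 costs the extra factor: [2 ^ (e + 1) <= 2 * (2 ^ e) ^ 2]. *)
Lemma leq_totient_sq n : n <= 2 * totient n ^ 2.
Proof.
have [->//|n_gt0] := posnP n.
have [m co_2m Dn] := pfactor_coprime (isT : prime 2) n_gt0.
have odd_m : odd m by rewrite -coprime2n.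
rewrite [leqLHS]Dn [in leqRHS]Dn totient_coprime; last first.
  by rewrite coprime_sym coprimeXl.
rewrite expnMn mulnCA leq_mul ?odd_leq_totient_sq //.
case: (logn 2 n) => // e; rewrite totient_pfactor // mul1n /= expnS.
by rewrite leq_mul // -expnM leq_pexp2l // leq_pmulr.
Qed.

Lemma sq_lt_exp5_totient n : 1 < n -> n != 6 -> n ^ 2 < 5 ^ totient n.
Proof.
move=> n_gt1 n_neq6.
have le_n := leq_totient_sq n.
(* From 6 on, [4 * totient n ^ 4 < 5 ^ totient n]; below 6, [n <= 2 * 5 ^ 2 = 50] leaves a finite
   check. *)
have [phi_lt6|phi_ge6] := ltnP (totient n) 6; last first.
  have: forall k, 4 * (k + 6) ^ 4 < 5 ^ (k + 6).
    elim=> // k IHk; rewrite addSn [ltnRHS]expnS.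
    rewrite (@leq_ltn_trans (5 * (4 * (k + 6) ^ 4))) ?ltn_pmul2l //; nia.
  move/(_ (totient n - 6)); rewrite subnK // => /(leq_ltn_trans _)-> //.
  by rewrite (leq_trans (leq_mul le_n le_n)) //; rewrite mulnACA -expnD.
have n_lt51 : n < 51 by nia.
have: all (fun n => (n != 6) ==> (n ^ 2 < 5 ^ totient n)) (iota 2 49) by [].
by move/allP/(_ n); rewrite mem_iota n_gt1 n_neq6; apply.
Qed.

(* Index convention: [u n] is the usual Fibonacci number with index [2 n] for
   [0 < n]; the value at [0] is junk. *)
Definition u (n : nat) : nat := fib (2 * n).-1.

(** * Binet formula in the algebraic integers *)

Section Carmichael.
Local Open Scope ring_scope.

Definition sqrt5 : algC := sqrtC 5.
Definition alpha : algC := (3 + sqrt5) / 2.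
Definition beta : algC := (3 - sqrt5) / 2.

Lemma sqr_sqrt5 : sqrt5 ^+ 2 = 5. Proof. exact: sqrtCK. Qed.

Lemma sqrt5_gt0 : 0 < sqrt5. Proof. by rewrite sqrtC_gt0 ltr0n. Qed.

Lemma alpha_beta : alpha * beta = 1.
Proof. by rewrite /alpha /beta; field: sqr_sqrt5. Qed.

Lemma alphaBbeta : alpha - beta = sqrt5.
Proof. by rewrite /alpha /beta; field. Qed.

Lemma alpha_beta_root x : x \in [:: alpha; beta] -> x ^+ 2 = 3 * x - 1.
Proof.
by rewrite !inE => /orP[]/eqP->; rewrite /alpha /beta; field: sqr_sqrt5.
Qed.

Lemma Aint_alpha_beta x : x \in [:: alpha; beta] -> x \in Aint.
Proof.
move=> /alpha_beta_root Dx; pose p : {poly algC} := 'X^2 + (- 3%:P * 'X + 1).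
have sz : (size (- (3 : algC)%:P * 'X + 1)%R < size ('X^2 : {poly algC}))%N.
  rewrite size_polyXn (leq_ltn_trans (size_polyD _ _)) // gtn_max size_poly1.
  rewrite andbT -polyCN (leq_ltn_trans (size_polyMleq _ _)) // size_polyX.
  by rewrite addnC /= size_polyC; case: (_ != _).
apply: (@root_monic_Aint p).
- by rewrite /p rootE !hornerE Dx; apply/eqP; rewrite /=; ring.
- by rewrite monicE lead_coefDl // lead_coefXn.
apply/polyOverP=> i; rewrite !coefD coefXn -polyCN coefCM coefX coef1.
by rewrite !(rpredD, rpredM) ?rpredN ?rpred_nat.
Qed.

Lemma Aint_alpha : alpha \in Aint.
Proof. by apply: Aint_alpha_beta; rewrite !inE eqxx. Qed.

Lemma Aint_beta : beta \in Aint.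
Proof. by apply: Aint_alpha_beta; rewrite !inE eqxx orbT. Qed.

Lemma Aint_sqrt5 : sqrt5 \in Aint.
Proof. by rewrite -alphaBbeta rpredB ?Aint_alpha ?Aint_beta. Qed.

(** Starts at index 1 because the junk value [u 0 = 1] breaks the recurrence. *)
Lemma u_rec n : (u n.+3 + u n.+1 = 3 * u n.+2)%N.
Proof.
by rewrite /u !mulnS !addSn !add0n; move: (2 * n)%N => k /=; lia.
Qed.

Lemma Binet n : (0 < n)%N -> sqrt5 * (u n)%:R = alpha ^+ n - beta ^+ n.
Proof.
case: n => // n _; elim/ltn_ind: n => -[|[|n]] IHn.
- by rewrite mulr1 !expr1 alphaBbeta.
- rewrite (_ : u 2 = 3%N) // !alpha_beta_root ?inE ?eqxx ?orbT //.
  by rewrite /alpha /beta; field.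
have /(congr1 (fun k => k%:R : algC)) := u_rec n; rewrite natrD natrM => Hu.
have -> : (u n.+3)%:R = 3 * (u n.+2)%:R - (u n.+1)%:R :> algC.
  by rewrite -Hu addrK.
rewrite mulrBr mulrCA !IHn // -[n.+3]addn2 -[n.+2]addn1 -[n.+1]addn1.
rewrite -!addnA !exprD !expr1.
rewrite !alpha_beta_root ?inE ?eqxx ?orbT //; ring.
Qed.

(** * Divisibility properties of [u] *)

Lemma dvdA_natr (e m : nat) : (e%:R %| m%:R)%A = (e %| m)%N.
Proof. by rewrite -eqAmod0 eqAmod0_nat. Qed.

Lemma dvdA_mull e x y : x \in Aint -> (e %| y)%A -> (e %| (x * y)%R)%A.
Proof.
by move=> Zx dvd_y; rewrite -eqAmod0 -[0](mulr0 x) eqAmodMl ?eqAmod0.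
Qed.

Lemma dvdA_mulr e x y : y \in Aint -> (e %| x)%A -> (e %| (x * y)%R)%A.
Proof. by rewrite mulrC; apply: dvdA_mull. Qed.

Lemma dvdA_mul e f x y : (e %| x)%A -> (f %| y)%A -> ((e * f)%R %| (x * y)%R)%A.
Proof.
rewrite ![(_ %| _)%A]unfold_in mulf_eq0; case: (e =P 0) => [_ /eqP-> | _ /= Zx].
  by rewrite mul0r eqxx.
case: (f =P 0) => [_ /eqP-> | _ Zy]; first by rewrite mulr0 eqxx.
by rewrite invfM mulrACA; apply: rpredM.
Qed.

Lemma fib_gt0 n : (0 < fib n)%N.
Proof.
elim/ltn_ind: n => -[|[|n]] IHn //.
by rewrite -[fib _]/(fib n.+1 + fib n)%N addn_gt0 IHn.
Qed.

Lemma u_gt0 n : (0 < u n)%N. Proof. exact: fib_gt0. Qed.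

Lemma expr_alpha_beta n : alpha ^+ n * beta ^+ n = 1.
Proof. by rewrite -exprMn alpha_beta expr1n. Qed.

(** As [alpha * beta = 1], [alpha ^ (2 n) - 1] is [alpha ^ n - beta ^ n] times the unit [alpha ^ n].
    The factor [sqrt5] of the modulus is the one in Binet's formula. *)
Lemma prime_dvd_uE p n : (0 < n)%N -> (0 < p)%N ->
  (p %| u n)%N = (alpha ^+ (n * 2) == 1 %[mod (p%:R * sqrt5)%R])%A.
Proof.
move=> n_gt0 p_gt0; have s_neq0 := lt0r_neq0 sqrt5_gt0.
have p_neq0 : p%:R != 0 :> algC by rewrite pnatr_eq0 -lt0n.
have dvd_diff : (p%:R * sqrt5 %| (alpha ^+ n - beta ^+ n)%R)%A = (p %| u n)%N.
  rewrite -Binet // -eqAmod0_nat eqAmod0 !unfold_in mulf_eq0 !(negPf p_neq0).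
  rewrite (negPf s_neq0) /=; congr (_ \in Aint).
  by field; rewrite s_neq0 p_neq0.
have Da : alpha ^+ (n * 2) - 1 = alpha ^+ n * (alpha ^+ n - beta ^+ n).
  by rewrite mulrBr expr_alpha_beta muln2 -addnn exprD.
have Db : alpha ^+ n - beta ^+ n = beta ^+ n * (alpha ^+ (n * 2) - 1).
  by rewrite Da mulrA [beta ^+ n * _]mulrC expr_alpha_beta mul1r.
rewrite -dvd_diff /eqAmod; apply/idP/idP=> [dvd_p | dvd_p].
  by rewrite Da dvdA_mull ?rpredX ?Aint_alpha.
by rewrite Db dvdA_mull ?rpredX ?Aint_beta.
Qed.

Lemma eqAmodX e x y k : x \in Aint -> y \in Aint ->
  (x == y %[mod e])%A -> (x ^+ k == y ^+ k %[mod e])%A.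
Proof.
move=> Zx Zy eq_xy; elim: k => // k IHk.
by rewrite !exprS eqAmodM ?rpredX.
Qed.

Lemma dvd_u_gcd p i n : (0 < i)%N -> (0 < n)%N -> (0 < p)%N ->
  (p %| u i)%N -> (p %| u n)%N -> (p %| u (gcdn i n))%N.
Proof.
move=> i_gt0 n_gt0 p_gt0; rewrite !prime_dvd_uE ?gcdn_gt0 ?i_gt0 //.
(* Bezout in the exponents: [ki * i = kn * n + gcdn i n]. *)
case: (egcdnP n i_gt0) => ki kn Dk _; set e := p%:R * sqrt5 => ai an.
have Ea : alpha \in Aint := Aint_alpha.
have := eqAmodX ki (rpredX (i * 2) Ea) (rpred1 _) ai.
have := eqAmodX kn (rpredX (n * 2) Ea) (rpred1 _) an.
rewrite !expr1n -!exprM => akn aki.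
have Da : alpha ^+ (i * 2 * ki)
    = alpha ^+ (n * 2 * kn) * alpha ^+ (gcdn i n * 2).
  by rewrite -exprD; congr (_ ^+ _); lia.
rewrite Da in aki; apply: eqAmod_trans aki.
rewrite eqAmod_sym -[X in (_ == X %[mod _])%A]mul1r.
by apply: eqAmodMr; rewrite ?rpredX.
Qed.

Lemma dvd_u_mul p m k : (0 < m)%N -> (0 < k)%N -> (0 < p)%N ->
  (p %| u m)%N -> (p %| u (m * k))%N.
Proof.
move=> m_gt0 k_gt0 p_gt0; rewrite !prime_dvd_uE ?muln_gt0 ?m_gt0 // => am.
rewrite mulnAC exprM -[X in (_ == X %[mod _])%A](expr1n _ k).
by apply: eqAmodX; rewrite ?rpredX ?rpred1 ?Aint_alpha.
Qed.

(** Modulo 4 the sequence cycles through 1, 3, 0 and so avoids 2. This settles the case [q = 2] of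
    [u_quotient]. *)
Lemma four_dvd_u m : (0 < m)%N -> (2 %| u m)%N -> (4 %| u m)%N.
Proof.
have period k : [/\ u (3 * k).+1 %% 4 = 1, u (3 * k).+2 %% 4 = 3
                  & u (3 * k).+3 %% 4 = 0]%N.
  elim: k => // k [u1 u2 u3]; rewrite mulnS !addSn add0n.
  have := u_rec (3 * k); have := u_rec (3 * k).+1; have := u_rec (3 * k).+2.
  have := u_rec (3 * k).+3; split; lia.
case: m => // m _; rewrite (divn_eq m 3) mulnC.
have [] := period (m %/ 3)%N; move: (ltn_pmod m (isT : 0 < 3)%N) (m %/ 3)%N.
case: (m %% 3)%N => [|[|[|//]]] _ k; rewrite ?addn0 ?addn1 ?addn2; lia.
Qed.

(** * The quotient of [u (m * q)] by [u m] *)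

Lemma exprD_rem2 (R : comNzRingType) (x y : R) k :
  (x + y) ^+ k.+2 - y ^+ k.+2 = x * (k.+2%:R * y ^+ k.+1
    + x * \sum_(i < k.+1) (y ^+ (k - i) * x ^+ i) *+ 'C(k.+2, i.+2)).
Proof.
rewrite [x + y]addrC exprDn 2!big_ord_recl bin0 bin1 subn0 expr0 mulr1.
rewrite addrAC subrr add0r mulrDr; congr (_ + _).
  by rewrite /bump /= subSS subn0 -mulr_natl; ring.
rewrite !mulr_sumr; apply: eq_bigr => i _.
rewrite !mulrnAr -[lift _ _ : nat]/(i.+2) !subSS !exprS; congr (_ *+ _); ring.
Qed.

(* Expand [alpha ^ (m q) = (beta ^ m + sqrt5 * u m) ^ q] binomially. *)
Lemma u_quotient q m Q : prime q -> (0 < m)%N ->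
  sqrt5 * (u (m * q))%:R = sqrt5 * (u m)%:R * Q ->
  exists R, [/\ R \in Aint, Q = q%:R * (beta ^+ m) ^+ q.-1 + (u m)%:R * R
    & (q %| u m)%N -> ((q ^ 2)%:R %| ((u m)%:R * R)%R)%A].
Proof.
move=> q_pr m_gt0.
have Du_neq0 : sqrt5 * (u m)%:R != 0.
  by rewrite mulf_neq0 ?(lt0r_neq0 sqrt5_gt0) // pnatr_eq0 -lt0n u_gt0.
rewrite Binet ?muln_gt0 ?m_gt0 ?prime_gt0 // !exprM.
have := Binet m_gt0; set D := sqrt5 * _ in Du_neq0 *; set A := alpha ^+ m.
set B := beta ^+ m => /esym/eqP; rewrite subr_eq => /eqP ->.
have ZB : B \in Aint by rewrite rpredX ?Aint_beta.
have ZD : D \in Aint by rewrite rpredM ?Aint_sqrt5 ?Aint_Cnat ?natr_nat.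
have [k Dq] : exists k, q = k.+2 by case: q q_pr => [|[|k]] // _; exists k.
set S := \sum_(i < k.+1) (B ^+ (k - i) * D ^+ i) *+ 'C(q, i.+2).
have -> : (D + B) ^+ q - B ^+ q = D * (q%:R * B ^+ q.-1 + D * S).
  by rewrite /S Dq exprD_rem2.
move/(mulfI Du_neq0) => <-; exists (sqrt5 * S); split.
- rewrite rpredM ?Aint_sqrt5 ?rpred_sum // => i _.
  by apply: rpredMn; apply: rpredM; apply: rpredX.
- by rewrite mulrA [_ * sqrt5]mulrC.
move=> q_dvd; have qA : (q%:R %| (u m)%:R)%A by rewrite dvdA_natr.
rewrite mulrCA dvdA_mull ?Aint_sqrt5 //.
(* For [q = 2], [S = 1] and [u m] alone supplies the factor 4; for [q > 2], [u m] and [S] supply one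
   factor [q] each. *)
case: k Dq @S => [|k] Dq S.
  rewrite /S big_ord1 Dq binn !expr0 !mulr1.
  rewrite (dvdA_natr (2 ^ 2)).
  by apply: four_dvd_u => //; rewrite -Dq.
rewrite natrX expr2 dvdA_mul // /S big_ord_recr /=.
rewrite rpredD ?rpred_sum // => [i _|].
  have : (q %| 'C(q, i.+2))%N.
    by apply: prime_dvd_bin => //; rewrite Dq /=; exact: (ltn_ord i).
  rewrite -mulr_natr => dvd_bin; apply: dvdA_mull; last by rewrite dvdA_natr.
  by apply: rpredM; apply: rpredX.
(* The last term has binomial coefficient 1, but contains [D] because [q > 2]. *)
rewrite Dq binn mulr1n -Dq exprS; apply: dvdA_mull; first exact: rpredX.
apply: dvdA_mulr; first exact: rpredX.
by rewrite dvdA_mull ?Aint_sqrt5.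
Qed.

(** Modulo [u m], [Q] is [q] times a unit, so [p] divides [q]. Once [p = q], this also holds modulo
    [q ^ 2], which does not divide [q]. *)
Lemma prime_dvd_u_quotient p q m Q : prime p -> prime q -> (0 < m)%N ->
  sqrt5 * (u (m * q))%:R = sqrt5 * (u m)%:R * Q -> (p %| u m)%N ->
  (p%:R %| Q)%A -> p = q /\ ~~ ((p ^ 2)%:R %| Q)%A.
Proof.
move=> p_pr q_pr m_gt0 DQ p_dvd p_Q.
have [R [ZR defQ dvd_q2]] := u_quotient q_pr m_gt0 DQ.
have Zinv : (alpha ^+ m) ^+ q.-1 \in Aint by rewrite !rpredX ?Aint_alpha.
have cancelB : (alpha ^+ m) ^+ q.-1 * (q%:R * (beta ^+ m) ^+ q.-1) = q%:R.
  by rewrite mulrCA -exprMn expr_alpha_beta expr1n mulr1.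
have dvd_nat e : (e%:R %| Q)%A -> (e%:R %| ((u m)%:R * R)%R)%A -> (e %| q)%N.
  move=> eQ eR; rewrite -dvdA_natr -cancelB dvdA_mull //.
  by rewrite -[_ * _](addrK ((u m)%:R * R)) -defQ rpredB.
have Dpq : p = q.
  apply/eqP; rewrite -(dvdn_prime2 p_pr q_pr) dvd_nat // dvdA_mulr //.
  by rewrite dvdA_natr.
split=> //; apply/negP=> p2_Q.
move: p_dvd p2_Q; rewrite Dpq => /dvd_q2 q2_R q2_Q.
have := dvd_nat _ q2_Q q2_R.
by rewrite -[X in (_ %| X)%N]expn1 dvdn_Pexp2l // prime_gt1.
Qed.

(** * Cyclotomic factors and primitive primes *)

(* The factor of [alpha ^ n - beta ^ n] over the primitive [n]-th roots of
   unity; as [alpha * beta = 1] it is a value of a cyclotomic polynomial. *)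
Definition cyclo n : algC :=
  beta ^+ totient n * (map_poly intr (Cyclotomic n)).[alpha ^+ 2].

Lemma Aint_cyclo n : cyclo n \in Aint.
Proof.
rewrite rpredM ?rpredX ?Aint_beta // horner_poly.
rewrite rpred_sum // => i _; rewrite rpredM ?Aint_int ?rpredX ?Aint_alpha //.
Qed.

(** Compares degrees in the cyclotomic factorization of [X^n - 1]. *)
Lemma sum_totient n : (0 < n)%N -> (\sum_(d <- divisors n) totient d)%N = n.
Proof.
move=> n_gt0.
have := congr1 (fun p : {poly int} => size p) (prod_Cyclotomic n_gt0).
rewrite size_XnsubC // size_prod_seq => [|d _]; last first.
  by rewrite monic_neq0 ?Cyclotomic_monic.
under eq_bigr do rewrite size_Cyclotomic -addn1.
by rewrite big_split /= sum1_size -addSn addnK => -[].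
Qed.

Lemma prod_cyclo n : (0 < n)%N ->
  \prod_(d <- divisors n) cyclo d = alpha ^+ n - beta ^+ n.
Proof.
move=> n_gt0; rewrite big_split /= prodrXr sum_totient //.
rewrite -horner_prod -rmorph_prod /= prod_Cyclotomic //.
rewrite rmorphB rmorph1 /= map_polyXn !hornerE -exprM mulnC exprM.
rewrite mulrBr mulr1 expr2.
by rewrite mulrA [beta ^+ n * _]mulrC expr_alpha_beta mul1r.
Qed.

(** Each root of unity [w] contributes [beta * (alpha ^ 2 - w) = alpha - beta * w], of norm at least
    [alpha - beta = sqrt5]. *)
Lemma norm_cyclo_ge n : (0 < n)%N -> sqrt5 ^+ totient n <= `|cyclo n|.
Proof.
move=> n_gt0; have [z prim_z] := C_prim_root_exists n_gt0.
have card_k : #|[pred k : 'I_n | coprime k n]| = totient n.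
  rewrite totient_count_coprime big_mkord -sum1_card big_mkcond /=.
  by apply: eq_bigr => k _; rewrite inE coprime_sym; case: coprime.
rewrite /cyclo (Cintr_Cyclotomic prim_z) /cyclotomic horner_prod -card_k.
rewrite -!prodr_const -big_split /= normr_prod.
apply: ler_prod => k _; rewrite (ltW sqrt5_gt0) /= !hornerE.
rewrite mulrBr expr2 mulrA [beta * _]mulrC alpha_beta mul1r.
have beta_ge0 : 0 <= beta.
  rewrite divr_ge0 // subr_ge0 -(ler_pXn2r (n := 2)) ?nnegrE ?ltW ?sqrt5_gt0 //.
  by rewrite sqr_sqrt5 -natrX ltr_nat.
have alpha_ge0 : 0 <= alpha by rewrite divr_ge0 ?addr_ge0 ?ltW ?sqrt5_gt0.
rewrite -alphaBbeta (le_trans _ (lerB_dist _ _)) // (normrM beta) normrX.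
have -> : `|z| = 1.
  apply/eqP; rewrite -(pexpr_eq1 n_gt0) ?normr_ge0 // -normrX.
  by rewrite (prim_expr_order prim_z) normr1.
by rewrite expr1n mulr1 !ger0_norm.
Qed.

(** Splits the divisors of [n] into [n], those of [m], and the rest; thus [cyclo n] divides the
    quotient of [u n] by [u m]. *)
Lemma u_eq_cyclo_mul n m : (0 < n)%N -> (m %| n)%N -> (m < n)%N ->
  sqrt5 * (u n)%:R = sqrt5 * (u m)%:R *
    (cyclo n * \prod_(d <- divisors n | (d != n) && ~~ (d %| m)%N) cyclo d).
Proof.
move=> n_gt0 m_dvd m_lt; have m_gt0 := dvdn_gt0 n_gt0 m_dvd.
rewrite !Binet // -!prod_cyclo // (bigD1_seq n) ?divisors_uniq //=; last first.
  by rewrite -dvdn_divisors.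
rewrite (bigID (fun d => d %| m)%N) /= mulrCA; congr (_ * _).
rewrite -big_filter; apply: perm_big.
apply: uniq_perm; rewrite ?filter_uniq ?divisors_uniq // => d.
rewrite mem_filter -!dvdn_divisors //.
apply/andP/idP=> [[/andP[]]|dm] //; rewrite dm (dvdn_trans dm) // andbT.
by split=> //; apply: contraTneq dm => ->; rewrite gtnNdvd.
Qed.

Lemma cyclo_neq0 n : (0 < n)%N -> cyclo n != 0.
Proof.
move=> n_gt0; rewrite -normr_gt0 (lt_le_trans _ (norm_cyclo_ge n_gt0)) //.
by rewrite exprn_gt0 ?sqrt5_gt0.
Qed.

(** By induction [cyclo n] is [u n] divided by an integer, hence a rational algebraic integer. At
    [n = 1] the value is [sqrt5]. *)
Lemma cyclo_int n : (1 < n)%N -> cyclo n \in Num.int.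
Proof.
elim/ltn_ind: n => n IHn n_gt1; have n_gt0 := ltnW n_gt1.
have s_neq0 := lt0r_neq0 sqrt5_gt0; have := cyclo_neq0 n_gt0.
have := u_eq_cyclo_mul n_gt0 (dvd1n n) n_gt1; set w := \prod_(d <- _ | _) _.
rewrite mulr1 => /(mulfI s_neq0) Du y_neq0.
have Zw : w \in Num.int.
  rewrite /w big_seq_cond rpred_prod // => d /andP[d_dvd /andP[d_neqn d_neq1]].
  rewrite -dvdn_divisors // in d_dvd; have d_gt0 := dvdn_gt0 n_gt0 d_dvd.
  rewrite dvdn1 in d_neq1; apply: IHn; last by rewrite ltn_neqAle eq_sym d_neq1.
  by rewrite ltn_neqAle d_neqn dvdn_leq.
have w_neq0 : w != 0.
  have : (u n)%:R != 0 :> algC by rewrite pnatr_eq0 -lt0n u_gt0.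
  by rewrite Du mulf_eq0 => /norP[].
apply: Cint_rat_Aint (Aint_cyclo n); rewrite -[cyclo n](mulfK w_neq0) -Du.
rewrite rpred_div ?rpred_nat //.
by have /intrP[k ->] := Zw; rewrite rpred_int.
Qed.

Lemma cyclo_bound n : (0 < n)%N -> cyclo n \in Num.int ->
  exists2 N : nat, `|cyclo n| = N%:R & (5 ^ totient n <= N ^ 2)%N.
Proof.
move=> n_gt0 /natr_norm_int/natrP[N DN]; exists N => //.
rewrite -(ler_nat algC) !natrX -DN -sqr_sqrt5 -exprM mulnC exprM.
by rewrite lerXn2r ?nnegrE ?exprn_ge0 ?norm_cyclo_ge // ltW ?sqrt5_gt0.
Qed.

(* Carmichael's theorem.  A non-primitive prime factor [p] of [cyclo n] divides
   some [u m] with [n = m q] and [q] prime, which forces [p = q] and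
   [p ^ 2] not dividing [cyclo n]; were all of them non-primitive, [cyclo n]
   would divide [n]. *)
Lemma primitive_prime n : (1 < n)%N -> n != 6 ->
  exists p, [/\ prime p, (p %| u n)%N
    & forall i, (0 < i < n)%N -> ~~ (p %| u i)%N].
Proof.
move=> n_gt1 n_neq6; have n_gt0 := ltnW n_gt1.
pose primitive p := [forall i : 'I_n, (0 < i)%N ==> ~~ (p %| u i)%N].
have [/hasP[p]|/hasPn no_prim] := boolP (has primitive (primes (u n))).
  rewrite mem_primes => /and3P[p_pr _ p_dvd] /forallP prim_p.
  exists p; split=> // i /andP[i_gt0 i_lt].
  exact: implyP (prim_p (Ordinal i_lt)) i_gt0.
have [N DN le_N] := cyclo_bound n_gt0 (cyclo_int n_gt1).
have N_gt0 : (0 < N)%N by rewrite -(sqrn_gt0 N) (leq_trans _ le_N) ?expn_gt0.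
have dvd_cyclo e : (e%:R %| cyclo n)%A = (e %| N)%N.
  rewrite -dvdA_natr -DN.
  have [//|_] := real_ge0P (Rreal_int (cyclo_int n_gt1)).
  by rewrite rpredN.
have Zprod m :
    \prod_(d <- divisors n | (d != n) && ~~ (d %| m)%N) cyclo d \in Aint.
  by apply: rpred_prod => d _; apply: Aint_cyclo.
have Nu : (N %| u n)%N.
  have := u_eq_cyclo_mul n_gt0 (dvd1n n) n_gt1; rewrite mulr1.
  move/(mulfI (lt0r_neq0 sqrt5_gt0)) => Du.
  by rewrite -dvdA_natr Du dvdA_mulr // dvd_cyclo.
(* Then [5 ^ totient n <= N ^ 2 <= n ^ 2], against the totient bound. *)
suff N_dvd : (N %| n)%N.
  have := sq_lt_exp5_totient n_gt1 n_neq6; rewrite ltnNge => /negP[].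
  by rewrite (leq_trans le_N) // leq_exp2r // dvdn_leq.
apply/(dvdn_partP _ N_gt0) => p; rewrite mem_primes => /and3P[p_pr _ p_N].
have p_gt0 := prime_gt0 p_pr; have p_un := dvdn_trans p_N Nu.
have /no_prim : p \in primes (u n) by rewrite mem_primes p_pr u_gt0.
rewrite negb_forall => /existsP[i].
rewrite negb_imply negbK => /andP[i_gt0 p_ui].
have p_ug := dvd_u_gcd i_gt0 n_gt0 p_gt0 p_ui p_un.
set g := gcdn i n in p_ug; have g_dvd : (g %| n)%N by apply: dvdn_gcdr.
have g_gt0 : (0 < g)%N by rewrite gcdn_gt0 i_gt0.
have g_lt : (g < n)%N.
  by rewrite (leq_ltn_trans _ (ltn_ord i)) // dvdn_leq ?dvdn_gcdl.
have ng_gt1 : (1 < n %/ g)%N by rewrite ltn_divRL // mul1n.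
(* Enlarge [g] to a divisor [m] of [n] of prime index [q]; [p] still divides [u m]. *)
pose q := pdiv (n %/ g); have q_pr : prime q by apply: pdiv_prime.
have q_dvd : (q %| n %/ g)%N by apply: pdiv_dvd.
pose m := (g * (n %/ g %/ q))%N.
have Dn : n = (m * q)%N by rewrite /m -mulnA divnK // mulnC divnK.
have mq_gt0 : (0 < n %/ g %/ q)%N.
  by rewrite divn_gt0 ?prime_gt0 // dvdn_leq // ltnW.
have m_gt0 : (0 < m)%N by rewrite muln_gt0 g_gt0.
have m_lt : (m < n)%N by rewrite [ltnRHS]Dn ltn_Pmulr ?prime_gt1.
have m_dvd : (m %| n)%N by rewrite Dn dvdn_mulr.
have p_um : (p %| u m)%N by apply: dvd_u_mul.
have := u_eq_cyclo_mul n_gt0 m_dvd m_lt; rewrite {1}Dn => DQ.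
have [] := prime_dvd_u_quotient p_pr q_pr m_gt0 DQ p_um.
  by rewrite dvdA_mulr ?dvd_cyclo.
(* The [p]-part of [N] is therefore at most [p = q], a factor of [n]. *)
move=> Dp not_p2; rewrite p_part.
have : (logn p N <= 1)%N.
  rewrite leqNgt -pfactor_dvdn //; apply: contra not_p2 => p2_N.
  by rewrite dvdA_mulr ?dvd_cyclo.
by case: (logn p N) => [|[|]] // _; rewrite expn1 Dp Dn dvdn_mull.
Qed.

End Carmichael.

(** * Products of distinct terms *)

Lemma u_ndvd_prod n (l : seq nat) : 1 < n -> uniq l ->
  {in l, forall i, 1 < i < n} -> ~~ (u n %| \prod_(i <- l) u i).
Proof.
move=> n_gt1 l_uniq l_lt; have [Dn|n_neq6] := eqVneq n 6.
  have l_sub : perm_eq l [seq i <- [:: 2; 3; 4; 5] | i \in l].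
    apply: uniq_perm; rewrite ?filter_uniq // => i; rewrite mem_filter.
    case i_l: (i \in l) => //=; have := l_lt i i_l.
    by rewrite Dn; case: i {i_l} => [|[|[|[|[|[|]]]]]].
  (* The product over [l] divides [3 * 8 * 21 * 55], where 2 occurs only to the power 3, while
     [u 6 = 144] is divisible by 16. *)
  rewrite (perm_big _ l_sub) big_filter; apply/negP=> dvd_u.
  have: u n %| \prod_(i <- [:: 2; 3; 4; 5]) u i.
    by rewrite (bigID [in l]) /= dvdn_mulr.
  by rewrite Dn !big_cons big_nil.
have [p [p_pr p_un p_prim]] := primitive_prime n_gt1 n_neq6.
apply/negP=> /(dvdn_trans p_un); rewrite big_seq Euclid_dvd_prod // => p_l.
suff: \big[orb/false]_(i <- l | i \in l) (p %| u i) = false by rewrite p_l.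
rewrite big1_seq // => i /andP[i_l _]; apply: negbTE; apply: p_prim.
by have /andP[/ltnW-> ->] := l_lt i i_l.
Qed.

Lemma u_gt1 n : 0 < n -> 1 < u n.+1.
Proof.
case: n => // n _; rewrite /u !mulnS !addSn add0n; move: (2 * n)%N => k.
rewrite -[fib _]/(fib k.+2 + fib k.+1).
by have := fib_gt0 k.+1; have := fib_gt0 k.+2; lia.
Qed.

Lemma prod_u_neq1 n s : 0 < n -> \prod_(i <- n :: s) u i.+1 != 1.
Proof. by move=> /u_gt1; rewrite big_cons muln_eq1; case: (u _) => [|[]]. Qed.

(** Were [m < n], [u n.+1] would divide a product of distinct terms with indices strictly between 1
    and [n.+1]. *)
Lemma leq_max_prod_u n m ns ms : 0 < n ->
    sorted gtn (m :: ms) -> all (leq 1) (m :: ms) ->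
  \prod_(i <- n :: ns) u i.+1 = \prod_(i <- m :: ms) u i.+1 -> n <= m.
Proof.
move=> n_gt0 ms_decr ms_pos eq_prod; rewrite leqNgt; apply/negP=> m_lt.
have gtn_trans : transitive gtn by move=> x y z /= xy /ltn_trans->.
have ms_le i : i \in m :: ms -> 0 < i <= m.
  move=> i_ms; rewrite (allP ms_pos) //=.
  move: i_ms; rewrite inE => /predU1P[->//|i_ms]; apply: ltnW.
  by have /allP/(_ i i_ms) := order_path_min gtn_trans ms_decr.
have ms_uniq : uniq (m :: ms) := sorted_uniq gtn_trans ltnn ms_decr.
have := @u_ndvd_prod n.+1 (map S (m :: ms)).
rewrite big_map -eq_prod big_cons dvdn_mulr // map_inj_uniq; last first.
  exact: succn_inj.
move/(_ n_gt0 ms_uniq) => no; have: false; last by [].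
apply: no => _ /mapP[i i_ms ->].
by have /andP[i_gt0 i_le] := ms_le i i_ms; rewrite !ltnS i_gt0
  (leq_ltn_trans i_le).
Qed.

Lemma prod_u_inj (ns ms : seq nat) :
    all (leq 1) ns -> sorted gtn ns -> all (leq 1) ms -> sorted gtn ms ->
  \prod_(n <- ns) u n.+1 = \prod_(m <- ms) u m.+1 -> ns = ms.
Proof.
elim: ns ms => [|n ns IHns] [|m ms] //.
- move=> _ _ /andP[m_gt0 _] _ /esym/eqP.
  by rewrite big_nil (negPf (prod_u_neq1 _ _)).
- move=> /andP[n_gt0 _] _ _ _ /eqP.
  by rewrite big_nil (negPf (prod_u_neq1 _ _)).
move=> ns_pos ns_decr ms_pos ms_decr eq_prod.
have /andP[n_gt0 ns_pos'] := ns_pos; have /andP[m_gt0 ms_pos'] := ms_pos.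
have Dn : n = m.
  apply/eqP; rewrite eqn_leq; apply/andP; split.
    exact: leq_max_prod_u eq_prod.
  exact: leq_max_prod_u (esym eq_prod).
move: eq_prod; rewrite !big_cons Dn => /eqP.
rewrite eqn_pmul2l ?u_gt0 // => /eqP eq_prod; congr (_ :: _).
by apply: IHns => //; [apply: path_sorted ns_decr | apply: path_sorted ms_decr].
Qed.

Theorem theorem3p6 (ns ms : seq nat)
  (ns_pos : all (leq 1) ns) (ns_decr : sorted gtn ns)
  (ms_pos : all (leq 1) ms) (ms_decr : sorted gtn ms)
  (ns_maj_ms : majorizes ns ms)
  (eq_prod : \prod_(n <- ns) fib (2 * n + 1) = \prod_(m <- ms) fib (2 * m + 1)) :
  size ns = size ms /\
  (forall i, i < size ns -> nth 0 ms i = nth 0 ns i).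
Proof.
(* The shift comes from [2 * n + 1 = (2 * n.+1).-1]. *)
have fibE s : \prod_(n <- s) fib (2 * n + 1) = \prod_(n <- s) u n.+1.
  by apply: eq_bigr => n _; rewrite /u mulnS addn1.
rewrite !fibE in eq_prod.
by rewrite (prod_u_inj ns_pos ns_decr ms_pos ms_decr eq_prod).
Qed.
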